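(* Let $R=(r_1,r_2,\ldots,r_n)$ be a nondecreasing vector of nonnegative integers such that there is an integer $t$ with $0\le t\le n$ such that $$\sum_{i=1}^n r_i=\binom{n}{2}+(n-t).$$ Let $R'=(t,r_1,r_2,\ldots,r_n)$. Then there is a bijection between $\mathcal{T}^{\ell}(R)$ and $\mathcal{T}(R')$. In particular, $\mathcal{T}^{\ell}(R)\ne\emptyset$ if and only if $\mathcal{T}(R')\ne\emptyset$. Moreover, these sets are nonempty if and only if $$\sum_{i=1}^k r_i\ge \binom{k}{2}+(k-t)^+\quad (k=1,2,\ldots,n),\ \mbox{ with equality when } k=n.$$
   Context: A loopy tournament of order $n$ is an $n\times n$ $(0,1)$-matrix $T=[t_{ij}]$ with $t_{ij}=1-t_{ji}$ for $i\ne j$, where each $t_{ii}$ may be $0$ or $1$; a tournament of order $n$ is such a matrix with $t_{ii}=0$ for all $i$. The score vector is the vector of row sums (diagonal entries included). $\mathcal{T}(R)$ denotes the set of all tournaments with score vector $R$, and $\mathcal{T}^{\ell}(R)$ the set of all loopy tournaments with score vector $R$. (Here $R'$ has $n+1$ entries, so $\mathcal{T}(R')$ consists of tournaments of order $n+1$.) For an integer $a$, $a^+=\max\{0,a\}$. *)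

(* Defs.v *)
From HB Require Import structures.
From mathcomp Require Import all_boot all_order all_algebra.

Set Implicit Arguments.
Unset Strict Implicit.
Unset Printing Implicit Defensive.

(* A (0,1)-matrix is a boolean matrix, the entries being read as 0 and 1 in nat
   through the coercion bool >-> nat; 1 - t is then ~~ t. *)
Definition loopy_tournament n (T : 'M[bool]_n) : bool :=
  [forall i, forall j, (i != j) ==> (T i j == ~~ T j i)].

Definition tournament n (T : 'M[bool]_n) : bool :=
  loopy_tournament T && [forall i, ~~ T i i].

Definition score_vector n (T : 'M[bool]_n) : n.-tuple nat :=
  [tuple \sum_(j < n) T i j | i < n].

Definition loopy_tournaments n (R : n.-tuple nat) : {set 'M[bool]_n} :=
  [set T | loopy_tournament T & score_vector T == R].

Definition tournaments n (R : n.-tuple nat) : {set 'M[bool]_n} :=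
  [set T | tournament T & score_vector T == R].

(* Indices start at 0, so this is the sum of the first k entries of R. *)
Definition partial_sum n (R : n.-tuple nat) (k : nat) : nat :=
  \sum_(i < n | i < k) tnth R i.

(* Main.v *)
Require Import Defs.
From HB Require Import structures.
From mathcomp Require Import all_boot all_order all_algebra.
From mathcomp Require Import zify.

Set Implicit Arguments.
Unset Strict Implicit.
Unset Printing Implicit Defensive.

(** The bijection trades loops for arcs at a new vertex 0: a loop at vertex i
becomes the arc from i to 0, and a missing loop becomes the arc from 0 to i.
Every old vertex keeps its score, and vertex 0 beats exactly the loopless
vertices.  Since the scores of a loopy tournament add up to 'C(n, 2) plus the
number of loops, the hypothesis on the sum of R says that there are n - t loops,
so that vertex 0 has score t ([mem_move_loops], [mem_restore_loops]).

It remains to decide when R' = (t, R) is the score vector of a tournament.  By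
Landau's theorem this happens if and only if every set A of vertices has total
prescribed score at least 'C(#|A|, 2), with equality for the set of all vertices
([tournaments_neq0P]).  R' need not be sorted, but R is: among the k-subsets of
the old vertices, the first k have the least total ([partial_sum_min]).  A set
avoiding vertex 0 then asks for 'C(k, 2) <= partial_sum R k, and a set containing
it asks for 'C(k, 2) + k <= t + partial_sum R k; the conjunction of both is the
condition with the positive part (k - t)^+ ([landau_cons]).

For the sufficiency in Landau's theorem ([landau_subsets]), take a tournament
that minimises the total excess of its scores over the prescribed ones.  If a
vertex u has too high a score, consider the set A of the vertices reachable from
u.  A vertex of A with too low a score would give a path from u whose reversal
moves one unit of score from u to that vertex and lowers the excess.  So no score
in A is too low, and as no arc leaves A, its scores add up to 'C(#|A|, 2), which
is then more than the prescribed total on A: a contradiction. *)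

(** * Scores and counting of arcs *)

Definition score n (T : 'M[bool]_n) (i : 'I_n) : nat := \sum_(j < n) T i j.

Lemma score_vectorP n (T : 'M[bool]_n) (R : n.-tuple nat) :
  reflect (forall i, score T i = tnth R i) (score_vector T == R).
Proof.
apply: (iffP eqP) => [<- i | eqTR]; first by rewrite tnth_mktuple.
by apply: eq_from_tnth => i; rewrite tnth_mktuple -eqTR.
Qed.

Lemma loopy_tournamentP n (T : 'M[bool]_n) :
  reflect (forall i j, i != j -> T i j = ~~ T j i) (loopy_tournament T).
Proof.
apply: (iffP 'forall_forallP) => HT i j; last by apply/implyP => /HT ->.
by move=> neq_ij; apply/eqP/(implyP (HT i j)).
Qed.

Lemma tournamentP n (T : 'M[bool]_n) :
  reflect ((forall i j, i != j -> T i j = ~~ T j i) /\ forall i, T i i = false)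
    (tournament T).
Proof.
apply: (iffP andP) => [[/loopy_tournamentP loT /forallP irrT] | [loT irrT]].
  by split=> // i; apply/negbTE.
by split; [apply/loopy_tournamentP | apply/forallP => i; rewrite irrT].
Qed.

(** Each pair of distinct vertices of A contributes one arc; adding the sum to
its transpose counts the ordered pairs, which avoids ordering the vertices. *)
Lemma loopy_sum_internal n (T : 'M[bool]_n) (A : {set 'I_n}) :
  loopy_tournament T ->
  \sum_(i in A) \sum_(j in A) (T i j : nat) = 'C(#|A|, 2) + \sum_(i in A) T i i.
Proof.
move/loopy_tournamentP=> loT; set S := LHS; set D := (X in _ = _ + X).
have S2 : S + S = #|A| * #|A|.-1 + (D + D).
  rewrite {2}/S exchange_big -!big_split /= -sum_nat_const -big_split /=.
  apply: eq_bigr => i Ai; rewrite -big_split /= (bigD1 i) //= addnC; congr (_ + _).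
  rewrite (eq_bigr (fun=> 1)) => [|j /andP[_ ne_ji]].
    rewrite sum1_card (cardD1 i A) Ai /=; apply: eq_card => j.
    by rewrite !inE andbC.
  by rewrite (loT _ _ ne_ji); case: (T i j).
have /eqP := mul_bin_left #|A| 1; rewrite bin1 subn1; nia.
Qed.

Lemma tournament_sum_internal n (T : 'M[bool]_n) (A : {set 'I_n}) :
  tournament T -> \sum_(i in A) \sum_(j in A) (T i j : nat) = 'C(#|A|, 2).
Proof.
move=> tT; have [_ irrT] := tournamentP _ tT.
rewrite loopy_sum_internal; last by case/andP: tT.
by rewrite [X in _ + X]big1 ?addn0 // => i _; rewrite irrT.
Qed.

Lemma total_score n (T : 'M[bool]_n) :
  loopy_tournament T -> \sum_(i < n) score T i = 'C(n, 2) + \sum_(i < n) T i i.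
Proof.
move=> loT.
transitivity (\sum_(i in [set: 'I_n]) \sum_(j in [set: 'I_n]) (T i j : nat)).
  by apply: eq_big => [i | i _]; [rewrite inE | apply: eq_bigl => j; rewrite inE].
rewrite loopy_sum_internal // cardsT card_ord; congr (_ + _).
by apply: eq_bigl => i; rewrite inE.
Qed.

Lemma tournament_total_score n (T : 'M[bool]_n) :
  tournament T -> \sum_(i < n) score T i = 'C(n, 2).
Proof.
move=> tT; have [_ irrT] := tournamentP _ tT.
rewrite total_score; last by case/andP: tT.
by rewrite [X in _ + X]big1 ?addn0 // => i _; rewrite irrT.
Qed.

Lemma tournament_subset_score n (T : 'M[bool]_n) (A : {set 'I_n}) :
  tournament T -> 'C(#|A|, 2) <= \sum_(i in A) score T i.
Proof.
move=> tT; rewrite -(tournament_sum_internal A tT); apply: leq_sum => i _.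
by rewrite /score [leqRHS](bigID (mem A)) leq_addr.
Qed.

(** * Reversal of paths *)

(** The score equation is stated additively because scores are naturals.  The
last clause keeps the part of a path that avoids x intact, so that the reversal
of a path can proceed arc by arc. *)
Lemma reverse_arc n (T : 'M[bool]_n) (x y : 'I_n) :
    tournament T -> T x y ->
  exists T' : 'M[bool]_n,
    [/\ tournament T',
        forall i, score T' i + (i == x) = score T i + (i == y)
      & forall i j, i != x -> j != x -> T' i j = T i j].
Proof.
move=> tT Txy; have [loT irrT] := tournamentP _ tT.
have ne_xy : x != y by apply: contraTneq Txy => ->; rewrite irrT.
have Tyx : T y x = false by rewrite loT 1?eq_sym // Txy.
pose T' : 'M[bool]_n := (\matrix_(i, j)
  if (i == x) && (j == y) then false else
  if (i == y) && (j == x) then true else T i j)%R.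
exists T'; split=> [|i|i j /negbTE nix /negbTE njx].
- apply/tournamentP; split=> [i j ne_ij | i]; rewrite !mxE.
    rewrite (loT _ _ ne_ij) [(j == y) && _]andbC [(j == x) && _]andbC.
    case: ifP => [/andP[/eqP-> /eqP->] | _]; last by case: ifP.
    by rewrite (negbTE ne_xy).
  by rewrite irrT [(i == y) && _]andbC; case: (_ && _).
- rewrite /score; have [->|nix] := eqVneq i x.
    rewrite (negbTE ne_xy) (bigD1 y) //= [in RHS](bigD1 y) //= mxE !eqxx Txy /=.
    rewrite addn0 addnC; congr (_ + _); apply: eq_bigr => j /negbTE njy.
    by rewrite mxE njy andbF (negbTE ne_xy).
  have [->|niy] := eqVneq i y.
    rewrite (bigD1 x) //= [in RHS](bigD1 x) //= mxE !eqxx Tyx.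
    rewrite eq_sym (negbTE ne_xy) /= addn0 [RHS]addnC; congr (_ + _).
    apply: eq_bigr => j /negbTE njx.
    by rewrite mxE njx andbF eq_sym (negbTE ne_xy).
  by congr (_ + _); apply: eq_bigr => j _; rewrite mxE (negbTE nix) (negbTE niy).
- by rewrite mxE nix njx andbF.
Qed.

(** When the arcs are reversed one by one, each inner vertex loses a unit and gains one
back, so that only the two ends change their scores.  Uniqueness of the vertices
ensures that the rest of the path is still present after the first reversal. *)
Lemma reverse_path n (T : 'M[bool]_n) (x : 'I_n) (p : seq 'I_n) :
    tournament T -> path (fun i j => T i j) x p -> uniq (x :: p) ->
  exists2 T' : 'M[bool]_n, tournament T' &
    forall i, score T' i + (i == x) = score T i + (i == last x p).
Proof.
elim: p x T => [|y p IHp] x T tT /=; first by exists T.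
case/andP=> Txy pathT /andP[x_notin uniq_yp].
have [T1 [tT1 scT1 eqT1]] := reverse_arc tT Txy.
have pathT1 : path (fun i j => T1 i j) y p.
  have sub : {in predC1 x &, (fun i j => T i j) =2 (fun i j => T1 i j)}.
    by move=> i j; rewrite !inE => nix njx; rewrite eqT1.
  rewrite -(eq_in_path sub) //; apply/allP => z z_in.
  by rewrite inE; apply: contraNneq x_notin => <-.
have [T2 tT2 scT2] := IHp y T1 tT1 pathT1 uniq_yp.
by exists T2 => // i; have := scT1 i; have := scT2 i; lia.
Qed.

(** * Landau's theorem *)

(** The subtraction is truncated: vertices with too low a score do not count. *)
Definition excess n (s : 'I_n -> nat) (T : 'M[bool]_n) : nat :=
  \sum_(i < n) (score T i - s i).

Lemma exists_tournament n : exists T : 'M[bool]_n, tournament T.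
Proof.
exists (\matrix_(i, j) (i < j)%N)%R; apply/tournamentP; split=> [i j | i].
  by rewrite !mxE -val_eqE /=; case: ltngtP.
by rewrite mxE ltnn.
Qed.

(** Sufficiency in Landau's theorem, for scores in any order: reversing a path
improves a tournament unless the vertices reachable from a vertex of too high a
score form a set that violates the inequality. *)
Theorem landau_subsets n (s : 'I_n -> nat) :
    (forall A : {set 'I_n}, 'C(#|A|, 2) <= \sum_(i in A) s i) ->
    \sum_(i < n) s i = 'C(n, 2) ->
  exists2 T : 'M[bool]_n, tournament T & forall i, score T i = s i.
Proof.
move=> s_ge sum_s; have [T0 tT0] := exists_tournament n.
case: (@arg_minnP _ T0 (@tournament n) (excess s) tT0) => T tT minT.
exists T => //.
have sumT : \sum_(i < n) score T i = \sum_(i < n) s i.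
  by rewrite tournament_total_score.
case: (pickP (fun u => s u < score T u)) => [u /= gt_u | /= le_T]; last first.
  have le_i i : true -> score T i <= s i ?= iff (score T i == s i).
    by move=> _; split=> //; rewrite leqNgt le_T.
  have [_] := leqif_sum le_i; rewrite sumT eqxx => /esym/forallP eqT i.
  exact/eqP/eqT.
(* If a vertex of A had too low a score, reversing a path to it from u would
   lower the excess at u, without creating any at the other end. *)
pose A := [set v | connect (fun i j => T i j) u v].
have A_ge v : v \in A -> s v <= score T v.
  rewrite inE => /connectP[p0 path0 ->]; case: (shortenP path0) => p pathT uniqp _.
  have [T' tT' scT'] := reverse_path tT pathT uniqp.
  rewrite leqNgt; apply/negP => lt_v.
  have := minT T' tT'; rewrite leqNgt => /negP; apply.
  rewrite /excess (bigD1 u) //= [ltnRHS](bigD1 u) //= -addSn; apply: leq_add.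
    have := scT' u; rewrite eqxx; case: eqP => [eq_u|_]; last by lia.
    by move: lt_v; rewrite -eq_u; lia.
  apply: leq_sum => i /negbTE ne_iu; have := scT' i; rewrite ne_iu addn0 => ->.
  by case: eqP => [->|_]; rewrite ?addn0 // addn1 (eqP lt_v).
(* No arc leaves A, so the scores in A count only the arcs inside A. *)
have A_closed : \sum_(i in A) score T i = 'C(#|A|, 2).
  rewrite -(tournament_sum_internal A tT); apply: eq_bigr => i Ai.
  rewrite /score (bigID (mem A)) /= [X in _ + X]big1 ?addn0 // => j.
  apply: contraNeq; rewrite eqb0 negbK => Tij; move: Ai; rewrite !inE => Ai.
  exact: connect_trans Ai (connect1 _).
have Au : u \in A by rewrite inE connect0.
have := s_ge A; rewrite -A_closed leqNgt => /negP[].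
rewrite (bigD1 u) //= [ltnRHS](bigD1 u) //= -addSn; apply: leq_add => //.
by apply: leq_sum => i /andP[/A_ge].
Qed.

(** * Reduction to prefixes of a sorted vector *)

Lemma card_prefix n k : k <= n -> #|[set i : 'I_n | i < k]| = k.
Proof.
move=> le_kn; rewrite cardsE -sum1_card.
by rewrite (big_ord_narrow le_kn) sum1_card card_ord.
Qed.

(** The set I of the first [#|A|] indices has the size of A, so I minus A and
A minus I have the same size; the entry at the last index of I bounds the
entries on the former from above and those on the latter from below. *)
Lemma partial_sum_min n (R : n.-tuple nat) (A : {set 'I_n}) :
  sorted leq R -> partial_sum R #|A| <= \sum_(i in A) tnth R i.
Proof.
move=> sortedR; move def_k: #|A| => k.
have leqR a b : a <= b -> b < n -> nth 0 R a <= nth 0 R b.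
  move=> le_ab lt_bn; apply: (sorted_leq_nth leq_trans leqnn) => //;
  by rewrite inE size_tuple // (leq_ltn_trans le_ab).
have le_kn : k <= n by rewrite -[n in _ <= n]card_ord -def_k max_card.
pose I := [set i : 'I_n | i < k].
have cardI : #|I| = k by rewrite card_prefix.
have -> : partial_sum R k = \sum_(i in I) tnth R i.
  by apply: eq_bigl => i; rewrite inE.
have cardD : #|A :\: I| = #|I :\: A| by rewrite !cardsD cardI def_k setIC.
rewrite (big_setID A) [leqRHS](big_setID I) /= setIC leq_add2l.
pose c := nth 0 R k.-1.
apply: (@leq_trans (\sum_(i in I :\: A) c)).
  apply: leq_sum => i; rewrite !inE (tnth_nth 0) => /andP[_ lt_ik].
  by apply: leqR; lia.
rewrite sum_nat_const -cardD -sum_nat_const.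
apply: leq_sum => i; rewrite !inE (tnth_nth 0) => /andP[ge_ik _].
by apply: leqR; [lia | exact: ltn_ord].
Qed.

Lemma sum_set_recl n (F : 'I_n.+1 -> nat) (A : {set 'I_n.+1}) :
  \sum_(i in A) F i = (ord0 \in A) * F ord0 +
    \sum_(j in [set j | lift ord0 j \in A]) F (lift ord0 j).
Proof.
rewrite big_mkcond big_ord_recl -big_mkcond /=; congr (_ + _).
  by case: (ord0 \in A); rewrite ?mul1n ?mul0n.
by apply: eq_bigl => j; rewrite inE.
Qed.

Lemma card_set_recl n (A : {set 'I_n.+1}) :
  #|A| = (ord0 \in A) + #|[set j | lift ord0 j \in A]|.
Proof. by rewrite -!sum1_card sum_set_recl muln1. Qed.

(** A set with k old vertices, with or without vertex 0, is worst when the old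
vertices are the first k; the two resulting bounds on [partial_sum R k] combine
into the one with the truncated difference [k - t]. *)
Lemma landau_cons n (R : n.-tuple nat) (t : nat) : sorted leq R ->
  (forall A : {set 'I_n.+1},
     'C(#|A|, 2) <= \sum_(i in A) tnth [tuple of t :: R] i) <->
  (forall k, 1 <= k <= n -> 'C(k, 2) + (k - t) <= partial_sum R k).
Proof.
move=> sortedR; split=> [geA k /andP[k_gt0 le_kn] | ge_k A].
  have geI (b : bool) : 'C(b + k, 2) <= b * t + partial_sum R k.
    pose A : {set 'I_n.+1} :=
      [set i | if unlift ord0 i is Some j then j < k else b].
    have A0 : (ord0 \in A) = b by rewrite inE unlift_none.
    have AS : [set j | lift ord0 j \in A] = [set j : 'I_n | j < k].
      by apply/setP => j; rewrite !inE liftK.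
    have := geA A; rewrite card_set_recl sum_set_recl A0 AS card_prefix // tnth0.
    congr (_ <= _ + _); apply: eq_big => j; first by rewrite inE.
    by rewrite tnthS.
  by have /= := geI true; have /= := geI false; rewrite add0n binS bin1; lia.
rewrite card_set_recl sum_set_recl tnth0; under eq_bigr do rewrite tnthS.
set B := [set j | _].
have [->|B_gt0] := posnP #|B|; first by case: (_ \in A).
have le_Bn : #|B| <= n by rewrite -[n in _ <= n]card_ord max_card.
have geB : 'C(#|B|, 2) + (#|B| - t) <= \sum_(i in B) tnth R i.
  by apply: leq_trans (partial_sum_min B sortedR); rewrite ge_k ?B_gt0.
case: (_ \in A) => /=; last exact: leq_trans (leq_addr _ _) geB.
apply: leq_trans (leq_add (leqnn _) geB).
by rewrite add1n binS bin1 mul1n; move: #|B| => b; lia.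
Qed.

(** * Loops as arcs at a new vertex *)

(** The vertex [ord0] is new, and [lift ord0 i] stands for the old vertex i; the
test [i' != j'] erases the loops once they are recorded as arcs to [ord0]. *)
Definition move_loops n (T : 'M[bool]_n) : 'M[bool]_n.+1 := (\matrix_(i, j)
  match unlift ord0 i, unlift ord0 j with
  | Some i', Some j' => (i' != j') && T i' j'
  | Some i', None => T i' i'
  | None, Some j' => ~~ T j' j'
  | None, None => false
  end)%R.

Definition restore_loops n (T : 'M[bool]_n.+1) : 'M[bool]_n := (\matrix_(i, j)
  T (lift ord0 i) (if i == j then ord0 else lift ord0 j))%R.

Lemma move_loopsK n : cancel (@move_loops n) (@restore_loops n).
Proof.
move=> T; apply/matrixP => i j; rewrite !mxE liftK.
by have [->|ne_ij] := eqVneq i j; rewrite ?unlift_none ?liftK ?ne_ij.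
Qed.

Lemma restore_loopsK n :
  {in @tournament n.+1, cancel (@restore_loops n) (@move_loops n)}.
Proof.
move=> T /tournamentP[loT irrT]; apply/matrixP => i j; rewrite mxE.
case: (unliftP ord0 i) => [i'|] ->; case: (unliftP ord0 j) => [j'|] ->;
  rewrite ?mxE ?eqxx ?irrT //.
  by case: eqVneq => [->|]; rewrite ?irrT.
by rewrite [RHS]loT.
Qed.

Lemma move_loops_tournament n (T : 'M[bool]_n) :
  loopy_tournament T -> tournament (move_loops T).
Proof.
move/loopy_tournamentP=> loT; apply/tournamentP; split=> [i j | i].
  rewrite !mxE; case: (unliftP ord0 i) => [i'|] ->;
    case: (unliftP ord0 j) => [j'|] ->; rewrite ?negbK ?eqxx //.
  by rewrite (inj_eq lift_inj) [j' == i']eq_sym => ne_ij; rewrite ne_ij loT.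
by rewrite mxE; case: unliftP => // i' _; rewrite eqxx.
Qed.

Lemma restore_loops_loopy n (T : 'M[bool]_n.+1) :
  tournament T -> loopy_tournament (restore_loops T).
Proof.
case/tournamentP=> loT _; apply/loopy_tournamentP => i j ne_ij.
by rewrite !mxE [j == i]eq_sym (negbTE ne_ij) loT.
Qed.

Lemma score_move_loops_lift n (T : 'M[bool]_n) (i : 'I_n) :
  score (move_loops T) (lift ord0 i) = score T i.
Proof.
rewrite /score big_ord_recl mxE liftK unlift_none [RHS](bigD1 i) //=; congr (_ + _).
rewrite [RHS]big_mkcond; apply: eq_bigr => j _.
by rewrite mxE !liftK eq_sym; case: eqP.
Qed.

Lemma score_move_loops0 n (T : 'M[bool]_n) :
  score (move_loops T) ord0 + \sum_(i < n) T i i = n.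
Proof.
rewrite /score big_ord_recl mxE unlift_none -big_split /=.
rewrite -[RHS]card_ord -sum1_card; apply: eq_bigr => i _.
by rewrite mxE unlift_none liftK; case: (T i i).
Qed.

(** The loops number n - t, as the scores of a loopy tournament exceed 'C(n, 2)
by the number of its loops; the new vertex beats the other t vertices. *)
Lemma mem_move_loops n (R : n.-tuple nat) (t : nat) (T : 'M[bool]_n) :
    t <= n -> \sum_(i < n) tnth R i = 'C(n, 2) + (n - t) ->
    T \in loopy_tournaments R ->
  move_loops T \in tournaments [tuple of t :: R].
Proof.
move=> le_tn sumR; rewrite !inE => /andP[loT /score_vectorP scT].
rewrite move_loops_tournament //; apply/score_vectorP => i.
case: (unliftP ord0 i) => [i'|] ->.
  by rewrite score_move_loops_lift tnthS scT.
have := total_score loT; have := score_move_loops0 T.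
by rewrite tnth0 (eq_bigr _ (fun i _ => scT i)) sumR; lia.
Qed.

Lemma mem_restore_loops n (R : n.-tuple nat) (t : nat) (T : 'M[bool]_n.+1) :
  T \in tournaments [tuple of t :: R] -> restore_loops T \in loopy_tournaments R.
Proof.
rewrite !inE => /andP[tT /score_vectorP scT].
rewrite restore_loops_loopy //; apply/score_vectorP => i.
by rewrite -score_move_loops_lift restore_loopsK // scT tnthS.
Qed.

(** * The characterisation of the score vectors *)

Lemma tournaments_neq0P n (R : n.-tuple nat) :
  tournaments R != set0 <->
    (forall A : {set 'I_n}, 'C(#|A|, 2) <= \sum_(i in A) tnth R i) /\
    \sum_(i < n) tnth R i = 'C(n, 2).
Proof.
split=> [/set0Pn[T] | [geR sumR]].
  rewrite inE => /andP[tT /score_vectorP scT]; split=> [A|].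
    by under eq_bigr do rewrite -scT; apply: tournament_subset_score.
  by under eq_bigr do rewrite -scT; apply: tournament_total_score.
have [T tT scT] := landau_subsets geR sumR.
by apply/set0Pn; exists T; rewrite inE tT; apply/score_vectorP.
Qed.

(* Subtraction on nat is truncated at 0: n - t is exact since t <= n, and k - t
   is the positive part (k - t)^+. *)
Theorem theorem7 (n : nat) (R : n.-tuple nat) (t : nat)
    (R_nondecreasing : sorted leq R)
    (t_le_n : t <= n)
    (sumR : \sum_(i < n) tnth R i = 'C(n, 2) + (n - t)) :
  let R' : n.+1.-tuple nat := [tuple of t :: R] in
  let score_condition : Prop :=
    (forall k : nat, 1 <= k <= n -> 'C(k, 2) + (k - t) <= partial_sum R k) /\
    partial_sum R n = 'C(n, 2) + (n - t) in
  [/\ exists f : {T : 'M[bool]_n | T \in loopy_tournaments R} ->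
                 {T : 'M[bool]_n.+1 | T \in tournaments R'},
        bijective f,
      loopy_tournaments R != set0 <-> tournaments R' != set0,
      loopy_tournaments R != set0 <-> score_condition
    & tournaments R' != set0 <-> score_condition].
Proof.
move=> R' score_condition.
have same_emptiness : loopy_tournaments R != set0 <-> tournaments R' != set0.
  split=> /set0Pn[T RT]; apply/set0Pn.
    by exists (move_loops T); apply: mem_move_loops.
  by exists (restore_loops T); apply: mem_restore_loops RT.
have landauR' : tournaments R' != set0 <-> score_condition.
  have sumR' : \sum_(i < n.+1) tnth R' i = 'C(n.+1, 2).
    rewrite big_ord_recl tnth0; under eq_bigr do rewrite tnthS.
    by rewrite sumR binS bin1; lia.
  have partialR : partial_sum R n = 'C(n, 2) + (n - t).
    by rewrite -sumR; apply: eq_bigl => i; rewrite ltn_ord.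
  have := landau_cons t R_nondecreasing; have := tournaments_neq0P R'.
  by rewrite /score_condition; tauto.
split=> //; last by rewrite same_emptiness.
pose f (T : {T | T \in loopy_tournaments R}) : {T | T \in tournaments R'} :=
  exist (fun T0 => T0 \in _) _ (mem_move_loops t_le_n sumR (valP T)).
pose g (T : {T | T \in tournaments R'}) : {T | T \in loopy_tournaments R} :=
  exist (fun T0 => T0 \in _) _ (mem_restore_loops (valP T)).
exists f, g => T; apply: val_inj; first exact: move_loopsK.
by apply: restore_loopsK; have := valP T; rewrite inE => /andP[].
Qed.
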